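(* Let $r\ge 2$ and $2\le\ell_1\le\cdots\le\ell_r$ be integers. There is a constant $C$, depending only on $r,\ell_1,\dots,\ell_r$, such that every infinite $\mathcal L^{(r)}_{\ell_1,\dots,\ell_r}$-free sequence $A$ of positive integers satisfies $$\liminf_{x\to\infty}\frac{A(x)}{x}\,(x\log x)^{1/(\ell_1\cdots\ell_{r-1})}\le C.$$
   Context: A set $A$ of integers is called $\mathcal L^{(r)}_{\ell_1,\dots,\ell_r}$-free if $A$ contains no sumset $L_1+\cdots+L_r=\{\lambda_1+\cdots+\lambda_r:\lambda_i\in L_i\}$ with $L_i\subset\mathbb Z$ and $|L_i|=\ell_i$ for $i=1,\dots,r$ (the sums need not be pairwise distinct). An infinite sequence of positive integers is regarded as an infinite set $A$ of positive integers, and $A(x)=|A\cap[1,x]|$ is its counting function. *)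

(* Defs.v *)
From HB Require Import structures.
From mathcomp Require Export all_boot all_order all_algebra finmap.
From mathcomp Require Export all_classical all_reals all_analysis.

Set Implicit Arguments.
Unset Strict Implicit.
Unset Printing Implicit Defensive.

Export Order.TTheory GRing.Theory Num.Theory.
Export numFieldNormedType.Exports.
Local Open Scope classical_set_scope.
Local Open Scope ring_scope.

Definition sumset (r : nat) (L : 'I_r -> {fset int}) : set int :=
  [set n | exists2 lam : 'I_r -> int,
             (forall i, lam i \in L i) & n = \sum_(i < r) lam i].

Definition contains_L (r : nat) (l : 'I_r -> nat) (A : set int) : Prop :=
  exists2 L : 'I_r -> {fset int},
    (forall i, #|` L i| = l i) & sumset L `<=` A.

Definition L_free (r : nat) (l : 'I_r -> nat) (A : set int) : Prop :=
  ~ contains_L l A.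

(* The set below is finite for every x, so fset_set does not default to the
   empty set. *)
Definition counting (R : realType) (A : set int) (x : R) : nat :=
  #|` fset_set (A `&` [set n : int | (1 : R) <= n%:~R <= x])|.

(* Main.v *)
Require Import Defs.
From mathcomp Require Import ring zify.

Set Implicit Arguments.
Unset Strict Implicit.
Unset Printing Implicit Defensive.

(** The argument extends to sumsets the one by which Erdos showed that an
    infinite Sidon sequence is thin infinitely often.  Put
    p = l_1 * ... * l_(r-1), and for a scale N let D_i be the number of
    elements of A in the i-th interval of length N.

    Counting.  If L_1, ..., L_(r-1) have the prescribed sizes, then A contains
    fewer than l_r translates of L_1 + ... + L_(r-1), since l_r of them would
    form a forbidden sumset.  On the other hand, an interval holding D_i
    elements of A contains, on average over sets L_j of integers of size at
    most N, of the order of N (D_i / N)^p such translates or more, unless D_i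
    is small (apply the power mean inequality once for each factor).
    Comparing the two counts over the first N intervals gives
    D_1^p + ... + D_N^p <= K N^(p-1), with K depending only on the sizes:
    this is L_free_moment, deduced from box_moment.

    Dyadic scales.  Take N = 2^n, and let F_k be the number of elements of A in
    (2^(n+k-1), 2^(n+k)], or in [1, 2^n] if k = 0.  By the power mean
    inequality again, the normalized counts f_k = F_k / 2^((n+k)(1-1/p))
    satisfy f_0^p + ... + f_(n-1)^p <= K.  The normalized counting function
    G_k = A(2^(n+k)) / 2^((n+k)(1-1/p)) is a convolution of f with a geometric
    sequence, so the sum of the G_k is at most a constant times the sum of the
    f_k, hence at most a constant times n^(1-1/p).  Some k < n therefore has
    G_k <= C n^(-1/p) (dyadic_counting).  As log 2^(n+k) is of order n, this
    is the required bound at x = 2^(n+k).  The logarithm thus comes from the n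
    dyadic scales that share one moment bound. *)

(** * Elementary inequalities *)

(** The power mean inequality, with any upper bound Q on the number of terms.
    The inductive step is Chebyshev's sum inequality for the similarly ordered
    families a_i and a_i^(p+1). *)
Lemma sum_expr_le_card (R : realDomainType) (I : Type) (r : seq I)
    (a : I -> R) (Q p : nat) :
  (forall i, 0 <= a i)%R -> size r <= Q ->
  ((\sum_(i <- r) a i) ^+ p.+1 <= Q%:R ^+ p * \sum_(i <- r) a i ^+ p.+1)%R.
Proof.
move=> a_ge0 szQ.
elim: p => [|p IHp]; first by rewrite !expr1 expr0 mul1r.
have chebyshev : ((\sum_(i <- r) a i) * (\sum_(i <- r) a i ^+ p.+1) <=
    Q%:R * \sum_(i <- r) a i ^+ p.+2)%R.
  set S := (\sum_(i <- r) a i ^+ p.+2)%R.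
  have S_ge0 : (0 <= S)%R by apply: sumr_ge0 => i _; rewrite exprn_ge0.
  apply: (@le_trans _ _ ((size r)%:R * S)%R); last first.
    by rewrite ler_wpM2r// ler_nat.
  rewrite -(@ler_pMn2r _ 2)//.
  have -> : (((size r)%:R * S) *+ 2 = \sum_(i <- r) \sum_(j <- r)
      (a i ^+ p.+2 + a j ^+ p.+2))%R.
    under eq_bigr do rewrite big_split/= big_const_seq count_predT iter_addr_0.
    rewrite big_split/= sumrMnl big_const_seq count_predT iter_addr_0.
    by rewrite mulr2n mulr_natl.
  have -> : (((\sum_(i <- r) a i) * (\sum_(i <- r) a i ^+ p.+1)) *+ 2 =
      \sum_(i <- r) \sum_(j <- r) (a i * a j ^+ p.+1 + a j * a i ^+ p.+1))%R.
    rewrite mulr2n mulr_suml.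
    under [RHS]eq_bigr do rewrite big_split/= -mulr_sumr -mulr_suml.
    by rewrite big_split/= -mulr_suml -mulr_sumr.
  apply: ler_sum => i _; apply: ler_sum => j _.
  rewrite -subr_ge0.
  have -> : (a i ^+ p.+2 + a j ^+ p.+2 - (a i * a j ^+ p.+1 + a j * a i ^+ p.+1)
      = (a i - a j) * (a i ^+ p.+1 - a j ^+ p.+1))%R by rewrite !exprS; ring.
  have [ij|/ltW ij] := leP (a i) (a j).
    by rewrite mulr_le0// subr_le0// lerXn2r// nnegrE.
  by rewrite mulr_ge0// subr_ge0// lerXn2r// nnegrE.
rewrite exprS; apply: (le_trans (ler_wpM2l _ IHp)).
  exact: sumr_ge0.
by rewrite mulrCA exprSr -mulrA ler_wpM2l// exprn_ge0.
Qed.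

Lemma sum_expn_le_card (I : Type) (r : seq I) (a : I -> nat) (Q p : nat) :
  size r <= Q ->
  (\sum_(i <- r) a i) ^ p.+1 <= Q ^ p * \sum_(i <- r) a i ^ p.+1.
Proof.
move=> szQ.
have := @sum_expr_le_card int I r (fun i => (a i)%:R%R) Q p
  (fun=> ler0n _ _) szQ.
under [X in (_ <= _ * X)%R -> _]eq_bigr do rewrite -natrX.
by rewrite -!natr_sum -!natrX -natrM ler_nat.
Qed.

(** The falling factorial is comparable to D^l only when D is large compared
    to l; the successor on the right absorbs the small values of D. *)
Lemma expn_le_bin (D l : nat) : D ^ l <= (l.*2) ^ l * ('C(D, l)).+1.
Proof.
case: l => [|l]; first by rewrite !expn0 mul1n.
have [Dl|lD] := leqP D l.+1.*2.
  by apply: (@leq_trans (l.+1.*2 ^ l.+1)); rewrite ?leq_exp2r ?leq_pmulr.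
have falling k : (D - k) ^ k <= D ^_ k.
  elim: k => [//|k IHk]; rewrite ffactnSr expnSr leq_mul ?leq_sub2l//.
  by case: k IHk => // k; apply: leq_trans; rewrite leq_exp2r// leq_sub2l.
have factl k : k`! <= k ^ k.
  elim: k => [//|k IHk]; rewrite factS expnS leq_mul// (leq_trans IHk)//.
  by case: k {IHk} => // k; rewrite leq_exp2r.
apply: (@leq_trans (l.+1.*2 ^ l.+1 * 'C(D, l.+1))); last by rewrite leq_mul.
rewrite -mul2n expnMn -mulnA.
apply: (@leq_trans (2 ^ l.+1 * D ^_ l.+1)); last first.
  by rewrite leq_mul// -bin_ffact mulnC leq_mul.
apply: (@leq_trans (2 ^ l.+1 * (D - l.+1) ^ l.+1)); last by rewrite leq_mul.
by rewrite -expnMn leq_exp2r//; lia.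
Qed.

(** * Boxes: translates of sumsets *)

(** For Ls = [:: L_1; ...; L_k], this says that t + L_1 + ... + L_k lies in P.
    Removing L_1 first replaces P by the set of x with x + L_1 inside P, and
    box_moment is an induction along this replacement. *)
Fixpoint box_at (Ls : seq (seq int)) (P : pred int) : pred int :=
  if Ls is L :: Ls' then box_at Ls' (fun x => all (fun y => P (x + y)%R) L)
  else P.

Lemma box_atP (Ls : seq (seq int)) (P : pred int) (t : int) (lam : nat -> int) :
  box_at Ls P t -> (forall i, i < size Ls -> lam i \in nth [::] Ls i) ->
  P (t + \sum_(i < size Ls) lam i)%R.
Proof.
elim: Ls P lam => [|L Ls IH] P lam /=; first by rewrite big_ord0 addr0.
move=> /IH{}IH lamL; rewrite big_ord_recl/=.
have /allP/(_ _ (lamL 0 isT)) := IH (lam \o S) (fun i => lamL i.+1).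
by rewrite -addrA [X in P (_ + X)%R]addrC.
Qed.

Definition trace (N : nat) (P : pred int) : {set 'I_N} :=
  [set t : 'I_N | P (Posz t)].

(** The shifts range over [-N, N), so that for each base point t < N the points
    t + y cover the whole of [0, N). *)
Definition shifts (N : nat) (S : {set 'I_N.*2}) : seq int :=
  [seq Posz s - Posz N | s : 'I_N.*2 in S]%R.

Lemma shifts_uniq N (S : {set 'I_N.*2}) : uniq (shifts S).
Proof.
rewrite map_inj_uniq ?enum_uniq// => s t /addIr/eqP.
by rewrite eqz_nat => /eqP/val_inj.
Qed.

(** Double counting of the pairs (t, S) with t + S inside P: for every t < N,
    the shifts that send t into P include those that reach the points of P in
    [0, N), and S may be any set of l of them. *)
Lemma sum_trace_shifts (N l : nat) (P : pred int) :
  N * 'C(#|trace N P|, l) <=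
  \sum_(S : {set 'I_N.*2} | #|S| == l)
     #|trace N (fun x => all (fun y => P (x + y)%R) (shifts S))|.
Proof.
pose Y (t : 'I_N) := [set s : 'I_N.*2 | P (Posz t + (Posz s - Posz N))%R].
have mem_trace (S : {set 'I_N.*2}) t :
    (t \in trace N (fun x => all (fun y => P (x + y)%R) (shifts S))) =
    (S \subset Y t).
  rewrite inE/=; apply/allP/fintype.subsetP => [PS s sS|SY _ /mapP[s + ->]].
    by rewrite inE; apply: PS; apply: map_f; rewrite mem_enum.
  by rewrite mem_enum => /SY; rewrite inE.
have leY t : #|trace N P| <= #|Y t|.
  have lt_shift (x : 'I_N) : x + N - t < N.*2.
    by have := ltn_ord x; have := ltn_ord t; lia.
  rewrite -(card_in_imset (f := fun x => Ordinal (lt_shift x))); last first.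
    move=> x y _ _ /(congr1 val)/= xy; apply/val_inj => /=.
    by have := ltn_ord t; lia.
  apply/subset_leq_card/fintype.subsetP => _ /imsetP[x + ->]; rewrite !inE/=.
  by congr (P _); have := ltn_ord t; lia.
apply: (@leq_trans (\sum_(t : 'I_N) 'C(#|Y t|, l))).
  rewrite -[X in X * _]card_ord -sum_nat_const.
  by apply: leq_sum => t _; rewrite leq_bin2l.
under eq_bigr do rewrite -cards_draws -sum1dep_card.
rewrite [leqRHS](eq_bigr (fun S : {set 'I_N.*2} =>
  \sum_(t : 'I_N) (S \subset Y t : nat))); last first.
  move=> S _; rewrite -sum1_card big_mkcond/=.
  by apply: eq_bigr => t _; rewrite mem_trace; case: (S \subset Y t).
rewrite exchange_big/=; apply: leq_sum => t _.
rewrite big_mkcond [leqRHS]big_mkcond/=; apply: leq_sum => S _.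
by case: (S \subset Y t); case: (#|S| == l).
Qed.

Lemma card_sets_le (T : finType) (l : nat) :
  #|[set S : {set T} | #|S| == l]| <= #|T| ^ l.
Proof.
rewrite (_ : [set S | _] = [set S : {set T} | S \subset [set: T] & #|S| == l]).
  rewrite cards_draws cardsT.
  elim: l (#|T|) => [|l IH] n; first by rewrite bin0.
  case: n => [|n]; first by rewrite bin0n.
  apply: (@leq_trans (l.+1 * 'C(n.+1, l.+1))); first by rewrite leq_pmull.
  rewrite -mul_bin_diag expnS leq_mul// (leq_trans (IH n))//.
  by case: l {IH} => // l; rewrite leq_exp2r.
by apply/setP => S; rewrite !inE finset.subsetT.
Qed.

(** Here m bounds, for each choice of sets of the given sizes, the number of
    boxes that they form in the whole family (B_i).

    When l is added in front of ls, each set S of l shifts gives a new family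
    B_{i,S} = {x | x + S is inside B_i}, and a box of B_{i,S} is a box of B_i
    with S as additional factor.  So the induction hypothesis applies to this
    family for each S separately, with the same m.  By sum_trace_shifts, on
    average over S the set B_{i,S} has at least a constant times N (D_i / N)^l
    elements, where D_i is the size of B_i and is not too small.  The power
    mean inequality then turns the bound on the p-th moments of the B_{i,S}
    into one on the (l * p)-th moment of the B_i.

    The term #|I| accounts for the sets B_i too small to contain l
    elements. *)
Lemma box_moment (ls : seq nat) : all (leq 2) ls ->
  exists K : nat, forall (I : finType) (N m : nat) (B : I -> pred int),
    (forall Ls : seq (seq int), all uniq Ls -> map size Ls = ls ->
       \sum_i #|trace N (box_at Ls (B i))| <= m) ->
    N ^ 2 * \sum_i #|trace N (B i)| ^ (\prod_(l <- ls) l) <=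
    K * (m * N + #|I|) * N ^ (\prod_(l <- ls) l).
Proof.
elim: ls => [_|l ls IH /= /andP[l2 /[dup] ls2 /IH[K HK]]].
  exists 1 => I N m B /(_ [::] isT erefl)/= Bm.
  rewrite big_nil; under eq_bigr do rewrite expn1.
  have := leq_mul (leqnn N) (leq_mul Bm (leqnn N)); nia.
rewrite big_cons; set p := \prod_(j <- ls) j in HK *.
have p_gt0 : 0 < p.
  rewrite /p; elim: ls ls2 {IH HK p} => [|x s IHs] /=; first by rewrite big_nil.
  by rewrite big_cons muln_gt0 => /andP[x2 /IHs->]; rewrite andbT ltnW.
have e2 : 2 <= l * p by nia.
pose c := (l.*2 ^ l) ^ p * 2 ^ p.
(* c compares D^(l p) with C(D, l)^p + 1, and 2^(l p) comes from the length
   2 N of the range of shifts. *)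
exists (c * (2 ^ (l * p) * K + 1)) => I N m B Bm.
have [->|N_gt0] := posnP N; first by rewrite exp0n.
pose BS (S : {set 'I_N.*2}) i : pred int :=
  fun x => all (fun y => B i (x + y)%R) (shifts S).
have boundS (S : {set 'I_N.*2}) : #|S| == l ->
    N ^ 2 * \sum_i #|trace N (BS S i)| ^ p <= K * (m * N + #|I|) * N ^ p.
  move=> /eqP Sl; apply: HK => Ls uLs szLs; apply: (Bm (shifts S :: Ls)).
    by rewrite /= shifts_uniq.
  by rewrite /= szLs size_map -cardE Sl.
pose D i := #|trace N (B i)|.
pose Q := N.*2 ^ l.
have cardQ : #|[set S : {set 'I_N.*2} | #|S| == l]| <= Q.
  by rewrite (leq_trans (card_sets_le _ _))// card_ord.
have Cpow i : (N * 'C(D i, l)) ^ p <=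
    Q ^ p.-1 * \sum_(S : {set 'I_N.*2} | #|S| == l) #|trace N (BS S i)| ^ p.
  apply: (@leq_trans ((\sum_(S : {set 'I_N.*2} | #|S| == l)
      #|trace N (BS S i)|) ^ p)).
    by rewrite leq_exp2r// sum_trace_shifts.
  rewrite -(prednK p_gt0) -!(big_filter _ (fun S : {set 'I_N.*2} => #|S| == l)).
  by apply: sum_expn_le_card; rewrite size_filter -sum1_count sum1dep_card.
pose X := m * N + #|I|.
have sumC : N ^ 2 * \sum_i 'C(D i, l) ^ p <= 2 ^ (l * p) * K * X * N ^ (l * p).
  rewrite -(@leq_pmul2l (N ^ p)) ?expn_gt0 ?N_gt0//.
  apply: (@leq_trans (Q ^ p.-1 * \sum_(S : {set 'I_N.*2} | #|S| == l)
      (N ^ 2 * \sum_i #|trace N (BS S i)| ^ p))).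
    rewrite -big_distrr/= exchange_big/= mulnCA [leqRHS]mulnCA leq_mul2l.
    rewrite !big_distrr/= leq_sum ?orbT// => i _.
    by rewrite -expnMn.
  apply: (@leq_trans (Q ^ p.-1 * (Q * (K * X * N ^ p)))).
    rewrite leq_mul2l; apply/orP; right.
    apply: (leq_trans (leq_sum _ boundS)).
    by rewrite sum_nat_cond_const leq_mul2r cardQ orbT.
  rewrite mulnA -expnSr prednK// /Q -expnM -mul2n expnMn.
  by apply: eq_leq; ring.
have Dpow i : D i ^ (l * p) <= c * ('C(D i, l) ^ p + 1).
  rewrite expnM; apply: (@leq_trans ((l.*2 ^ l * ('C(D i, l)).+1) ^ p)).
    by rewrite leq_exp2r// expn_le_bin.
  rewrite expnMn /c -mulnA leq_mul2l; apply/orP; right.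
  case: 'C(D i, l) => [|u]; first by rewrite exp1n exp0n// muln1 expn_gt0.
  rewrite (@leq_trans (2 ^ p * u.+1 ^ p))// -?expnMn ?leq_exp2r//; first by lia.
  by rewrite expnMn leq_mul2l leq_addr orbT.
apply: (@leq_trans (N ^ 2 * (c * (\sum_i 'C(D i, l) ^ p + #|I|)))).
  rewrite leq_mul2l; apply/orP; right.
  apply: (leq_trans (leq_sum _ (fun i _ => Dpow i))).
  by rewrite -big_distrr/= big_split/= sum_nat_const muln1.
have N2 : N ^ 2 <= N ^ (l * p) by rewrite leq_pexp2l.
apply: (@leq_trans (c * (N ^ 2 * \sum_i 'C(D i, l) ^ p + N ^ 2 * #|I|))).
  by rewrite mulnCA mulnDr.
rewrite -/X; clearbody c; rewrite -!(mulnA c) leq_mul2l; apply/orP; right.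
rewrite (leq_trans (leq_add sumC (leq_mul N2 (leqnn _))))//.
have : #|I| <= X by rewrite /X leq_addl.
move: (N ^ _) (2 ^ _) => u v IX; nia.
Qed.

(** * Moments of a sumset-free set *)

(** The intervals start at 1, so the blocks of length N partition the positive
    integers. *)
Definition block (A : set int) (N i : nat) : pred int :=
  fun x => (Posz (i * N).+1 + x)%R \in A.

(** The base points of l_r boxes built from the same sets would serve as the
    last summand of a forbidden sumset. *)
Lemma L_free_box_count (k : nat) (l : 'I_k.+1 -> nat) (A : set int)
    (N M : nat) (Ls : seq (seq int)) :
  L_free l A -> all uniq Ls -> size Ls = k ->
  (forall i : 'I_k, size (nth [::] Ls i) = l (widen_ord (leqnSn k) i)) ->
  \sum_(i < M) #|trace N (box_at Ls (block A N i))| <= l ord_max.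
Proof.
move=> freeA uLs szLs lLs; rewrite leqNgt; apply/negP => big.
pose X := [set u : 'I_M * 'I_N | box_at Ls (block A N u.1) (Posz u.2)].
have cardX : l ord_max <= #|X|.
  apply: (leq_trans (ltnW big)); rewrite -sum1_card [leqRHS]big_mkcond/=.
  rewrite (eq_bigr (fun i : 'I_M => \sum_(t : 'I_N) ((i, t) \in X : nat))).
    by rewrite pair_bigA/=; apply: eq_leq; apply: eq_bigr => -[i t] _.
  move=> i _; rewrite -sum1_card big_mkcond/=.
  by apply: eq_bigr => t _; rewrite !inE.
(* The base point, in the coordinates of A, of the box found at u. *)
pose f (u : 'I_M * 'I_N) : int := Posz (u.1 * N + u.2).+1.
have f_inj : injective f.
  move=> [i t] [j s] [/= /eqP ijts].
  have := ltn_ord t; have := ltn_ord s => sN tN.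
  have N_gt0 : 0 < N by apply: leq_ltn_trans tN.
  have /eqP : (i * N + t) %% N = (j * N + s) %% N by rewrite (eqP ijts).
  rewrite !modnMDl !modn_small// => /eqP ts.
  move: ijts; rewrite ts eqn_add2r eqn_pmul2r// => /eqP ij.
  by congr pair; apply: val_inj.
pose s := [seq f u | u <- take (l ord_max) (enum X)].
have us : uniq s by rewrite map_inj_uniq// take_uniq// enum_uniq.
have szs : size s = l ord_max.
  by rewrite size_map size_take_min -cardE; apply/minn_idPl.
apply: freeA.
exists (fun i : 'I_k.+1 => seq_fset tt (if i < k then nth [::] Ls i else s)).
  move=> i; rewrite size_seq_fset undup_id; last first.
    case: ifP => // ik; apply: (allP uLs); rewrite mem_nth// szLs//.
  case: ifP => ik.
    by rewrite (lLs (Ordinal ik)); congr l; apply: val_inj.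
  rewrite szs; congr l; apply: val_inj => /=.
  by have := ltn_ord i; lia.
move=> _ [lam lamL ->]; rewrite big_ord_recr/=.
have := lamL ord_max; rewrite seq_fsetE/= ltnn => /mapP[u /mem_take].
rewrite mem_enum inE => /box_atP boxu ->.
have := boxu (fun i => lam (inord i)); rewrite szLs => /(_ _)/set_mem.
rewrite addrA -PoszD addSn addrC; rewrite /f.
have -> : (\sum_(i < k) lam (widen_ord (leqnSn k) i) =
    \sum_(i < k) lam (inord i))%R.
  apply: eq_bigr => i _; congr lam; apply: val_inj.
  by rewrite /= inordK// ltnS ltnW.
apply=> i ik; have := lamL (inord i).
by rewrite seq_fsetE/= (inordK (ltnW ik : i < k.+1)) ik.
Qed.

(** The bound of box_moment has two terms, of orders m N^(p-1) and
    #|I| N^(p-2).  The number of blocks is taken equal to N to have the second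
    not exceed the first. *)
Lemma L_free_moment (k : nat) (l : 'I_k.+2 -> nat) :
  (forall i, 2 <= l i) ->
  exists K : nat, forall A : set int, L_free l A -> forall N, 0 < N ->
    \sum_(i < N) #|trace N (block A N i)| ^ (\prod_(i < k.+2 | i.+1 < k.+2) l i)
    <= K * N ^ (\prod_(i < k.+2 | i.+1 < k.+2) l i).-1.
Proof.
move=> l2.
pose ls := [seq l (widen_ord (leqnSn k.+1) i) | i : 'I_k.+1].
have -> : \prod_(i < k.+2 | i.+1 < k.+2) l i = \prod_(j <- ls) j.
  rewrite big_mkcond big_ord_recr/= ltnn muln1 big_map enumT.
  by apply: eq_bigr => i _; rewrite ltnS ltn_ord.
have ls2 : all (leq 2) ls by apply/allP => _ /mapP[i _ ->].
have [K HK] := box_moment ls2.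
exists (K * (l ord_max).+1) => A freeA N N_gt0.
have := HK 'I_N N (l ord_max) (fun i => block A N i) _.
rewrite card_ord; set p := \prod_(j <- ls) j => moment.
have p_gt0 : 0 < p.
  by rewrite /p big_map big_seq prodn_cond_gt0// => i _; rewrite ltnW.
rewrite -(@leq_pmul2l (N ^ 2)) ?expn_gt0 ?N_gt0//.
apply: (leq_trans (moment _)).
  move=> Ls uLs szLs; have sz : size Ls = k.+1.
    by rewrite -(size_map size) szLs size_map -cardE card_ord.
  apply: L_free_box_count => // i.
  rewrite -(nth_map _ 0 size) ?sz// szLs (nth_map i) -?cardE ?card_ord//.
  by rewrite nth_ord_enum.
rewrite -(prednK p_gt0) expnS.
by apply: eq_leq => /=; ring.
Qed.

(** * Dyadic summation *)

Local Open Scope ring_scope.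

(** One moment bound, at scale 2^n, controls the n dyadic ranges
    up to 2^(n+k) with k < n at the same time.  With f_k and G_k the normalized
    numbers of elements in the k-th range and up to its end, the sum of the
    f_k^p is bounded, so the sum of the G_k is O(n^(1-1/p)), and the smallest
    G_k is O(n^(-1/p)). *)
Lemma dyadic_counting (R : realType) (p : nat) : (2 <= p)%N ->
  exists2 W : R, 0 <= W & forall (K : nat) (a : nat -> nat),
    (forall N, (0 < N)%N ->
       (\sum_(i < N) (\sum_(t < N) a (i * N + t)%N) ^ p <= K * N ^ p.-1)%N) ->
    forall n, (0 < n)%N -> exists2 k, (k < n)%N &
      n%:R * (\sum_(j < 2 ^ (n + k)) a j)%N%:R ^+ p <=
      W * K%:R * (2 ^+ (n + k)) ^+ p.-1.
Proof.
case: p => [//|p] /= p_gt0.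
(* The normalization b^(n+k) is x^(1-1/p) for x = 2^(n+k). *)
pose b : R := 2 `^ (p%:R / p.+1%:R).
have b_gt0 : 0 < b by rewrite powR_gt0.
have bX : b ^+ p.+1 = 2 ^+ p.
  by rewrite -powR_mulrn ?powR_ge0// -powRrM divfK ?pnatr_eq0// powR_mulrn.
have b_gt1 : 1 < b.
  rewrite ltNge; apply/negP => b1.
  have := exprn_ile1 p.+1 (ltW b_gt0) b1.
  by rewrite bX leNgt exprn_egt1 ?ltr1n// gtn_eqF.
have c_gt0 : 0 < 1 - b^-1 by rewrite subr_gt0 invf_lt1.
exists ((1 - b^-1) ^- p.+1) => [|K a moment n n_gt0].
  by rewrite invr_ge0 exprn_ge0// ltW.
pose D i := (\sum_(t < 2 ^ n) a (i * 2 ^ n + t))%N.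
(* (2^k)./2 is 2^(k-1), except that it is 0 for k = 0: the ranges partition
   the first 2^(n-1) blocks. *)
pose F k := (\sum_((2 ^ k)./2 <= i < 2 ^ k) D i)%N.
pose E k := (\sum_(0 <= i < 2 ^ k) D i)%N.
have halfS k : (2 ^ k.+1)./2 = (2 ^ k)%N by rewrite expnS mul2n doubleK.
have ES k : E k.+1 = (E k + F k.+1)%N.
  by rewrite /F halfS -big_cat_nat//= leq_exp2l.
have Ea k : E k = (\sum_(j < 2 ^ (n + k)) a j)%N.
  rewrite addnC expnD -(big_mkord xpredT) big_nat_mul.
  apply: eq_bigr => i _.
  rewrite -{1}[(i * 2 ^ n)%N]add0n big_addn mulSn addnK big_mkord.
  by apply: eq_bigr => t _; rewrite addnC.
pose f k : R := (F k)%:R / b ^+ (n + k).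
pose G k : R := (E k)%:R / b ^+ (n + k).
have f_ge0 k : 0 <= f k by rewrite divr_ge0// exprn_ge0// ltW.
have G_ge0 k : 0 <= G k by rewrite divr_ge0// exprn_ge0// ltW.
have G0 : G 0%N = f 0%N by [].
have GS k : G k.+1 = f k.+1 + G k / b.
  rewrite /G /f ES natrD addrC mulrDl; congr (_ + _).
  by rewrite addnS exprSr invfM mulrA.
have powf k : (F k)%:R ^+ p.+1 = f k ^+ p.+1 * (2 ^+ (n + k)) ^+ p.
  rewrite -exprM mulnC exprM -bX -!exprM mulnC exprM -exprMn divfK//.
  by rewrite gt_eqF// exprn_gt0.
have powG k : (E k)%:R ^+ p.+1 = G k ^+ p.+1 * (2 ^+ (n + k)) ^+ p.
  rewrite -exprM mulnC exprM -bX -!exprM mulnC exprM -exprMn divfK//.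
  by rewrite gt_eqF// exprn_gt0.
have sumf : \sum_(k < n) f k ^+ p.+1 <= K%:R.
  apply: (@le_trans _ _ (\sum_(k < n)
      (\sum_((2 ^ k)./2 <= i < 2 ^ k) D i ^ p.+1)%N%:R / (2 ^+ n) ^+ p)).
    apply: ler_sum => k _; rewrite ler_pdivlMr ?exprn_gt0//.
    rewrite -(@ler_pM2r _ ((2 ^+ k) ^+ p)) ?exprn_gt0//.
    rewrite -mulrA -exprMn -exprD -powf mulrC -!natrX -natrM ler_nat.
    apply: sum_expn_le_card; rewrite size_iota; exact: leq_subr.
  rewrite -mulr_suml ler_pdivrMr ?exprn_gt0// -!natrX -natrM -natr_sum ler_nat.
  apply: (leq_trans _ (moment _ _)); last by rewrite expn_gt0.
  rewrite -(big_mkord xpredT (fun i => D i ^ p.+1)%N).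
  rewrite -(big_mkord xpredT
    (fun k => \sum_((2 ^ k)./2 <= i < 2 ^ k) D i ^ p.+1)%N).
  have blocks m (h : nat -> nat) :
      (\sum_(0 <= k < m.+1) \sum_((2 ^ k)./2 <= i < 2 ^ k) h i =
       \sum_(0 <= i < 2 ^ m) h i)%N.
    elim: m => [|m IHm]; first by rewrite big_nat1.
    by rewrite big_nat_recr//= IHm halfS -big_cat_nat//= leq_exp2l.
  rewrite -[X in (\sum_(0 <= k < X) _)%N](prednK n_gt0) blocks.
  rewrite [leqRHS](@big_cat_nat _ _ _ (2 ^ n.-1))%N//= ?leq_addr//.
  by rewrite leq_exp2l// leq_pred.
(* Summing G_(k+1) = f_(k+1) + G_k / b over k. *)
have sumG : (1 - b^-1) * \sum_(k < n) G k <= \sum_(k < n) f k.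
  rewrite mulrBl mul1r lerBlDr -(prednK n_gt0).
  rewrite [leLHS]big_ord_recl [X in _ <= X + _]big_ord_recl G0 -addrA lerD2l.
  under eq_bigr do rewrite GS.
  rewrite big_split/= lerD2l -mulr_suml mulrC.
  rewrite ler_wpM2l ?invr_ge0 ?(ltW b_gt0)//.
  by rewrite big_ord_recr/= lerDl.
have [k0 _ minG] :=
  arg_minP (fun k : 'I_n => G k) (isT : xpredT (Ordinal n_gt0)).
exists k0 => //.
rewrite -Ea powG mulrA ler_wpM2r ?exprn_ge0//.
rewrite ler_pdivlMl ?exprn_gt0//.
rewrite -(@ler_pM2l _ (n%:R ^+ p)) ?exprn_gt0 ?ltr0n//.
apply: (@le_trans _ _ ((\sum_(k < n) f k) ^+ p.+1)); last first.
  apply: (le_trans (sum_expr_le_card (Q := n) _ _ _)) => //.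
    by rewrite /index_enum -enumT size_enum_ord.
  by rewrite ler_wpM2l ?exprn_ge0.
apply: (@le_trans _ _ (((1 - b^-1) * \sum_(k < n) G k) ^+ p.+1)); last first.
  by rewrite lerXn2r ?nnegrE ?mulr_ge0 ?sumr_ge0// ltW.
apply: (@le_trans _ _ (((1 - b^-1) * (n%:R * G k0)) ^+ p.+1)).
  rewrite !exprMn [n%:R ^+ p.+1]exprSr le_eqVlt; apply/orP; left; apply/eqP.
  by ring.
have c_ge0 := ltW c_gt0.
rewrite lerXn2r ?nnegrE// ?(mulr_ge0 c_ge0) ?sumr_ge0
  ?(mulr_ge0 _ (G_ge0 k0))//.
rewrite ler_wpM2l// mulr_natl -[X in _ *+ X]card_ord -sumr_const.
by apply: ler_sum => k _; apply: minG.
Qed.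

(** * The counting function and the lower limit *)

Lemma card_trace_block (A : set int) (N i : nat) :
  (#|trace N (block A N i)| =
   \sum_(t < N) (Posz (i * N + t).+1 \in A : nat))%N.
Proof.
rewrite -sum1_card big_mkcond/=; apply: eq_bigr => t _.
by rewrite inE /block -PoszD addSn; case: (_ \in A).
Qed.

Lemma counting_nat (R : realType) (A : set int) (M : nat) :
  counting A (M%:R : R) = (\sum_(j < M) (Posz j.+1 \in A : nat))%N.
Proof.
pose X := [seq Posz j.+1 | j <- iota 0 M & Posz j.+1 \in A].
have cardX : #|` seq_fset tt X| = size (undup X) := size_seq_fset _ _.
move: (seq_fset tt X) cardX (seq_fsetE tt X) => Y cardX memX.
rewrite /counting.
have -> : (A `&` [set n : int | (1 : R) <= n%:~R <= (M%:R : R)] =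
    [set` Y])%classic.
  apply/seteqP; split=> x /=; rewrite memX.
    move=> [Ax]; case: x Ax => [[|j]|j] Ax.
    - by rewrite ler10.
    - rewrite -pmulrn ler_nat => /andP[_ jM]; apply: map_f.
      by rewrite mem_filter mem_iota mem_set.
    - by move=> /andP[/le_trans + _] => /(_ 0); rewrite ler10 lerz0 => /(_ isT).
  move=> /mapP[j]; rewrite mem_filter mem_iota => /andP[/set_mem Aj jM] ->.
  by split=> //; rewrite -pmulrn ler1n ler_nat.
rewrite set_fsetK cardX undup_id.
  rewrite size_map size_filter -sum1_count big_mkcond/=.
  rewrite -(big_mkord xpredT (fun j => (Posz j.+1 \in A : nat))) /index_iota.
  rewrite subn0; apply: eq_bigr => j _.
  by case: (_ \in A).
by rewrite map_inj_uniq ?filter_uniq ?iota_uniq// => i j [].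
Qed.

Local Open Scope classical_set_scope.

Theorem theorem5 (R : realType) (r : nat) (hr : (2 <= r)%N) (l : 'I_r -> nat)
    (hl2 : forall i : 'I_r, (2 <= l i)%N)
    (hlmono : forall i j : 'I_r, (i <= j)%N -> (l i <= l j)%N) :
  exists C : R, forall A : set int,
    infinite_set A -> A `<=` [set n : int | 0 < n] -> L_free l A ->
    (limf_einf
       (fun x : R =>
          ((counting A x)%:R / x *
           (x * ln x) `^ ((\prod_(i < r | (i.+1 < r)%N) l i)%:R^-1))%:E)
       (pinfty_nbhs R) <= C%:E)%E.
Proof.
case: r hr l hl2 {hlmono} => [|[|k]]// _ l l2.
have [K HK] := L_free_moment l2.
move: HK; set p := (\prod_(i < _ | _) _)%N => HK.
have p2 : (2 <= p)%N.
  rewrite /p (bigD1 ord0)//= (leq_trans (l2 ord0))// leq_pmulr//.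
  by rewrite prodn_cond_gt0// => i _; rewrite ltnW.
have [W W_ge0 HW] := dyadic_counting R p2.
pose C0 := 2 * W * K%:R * ln (2 : R).
have ln2_ge0 : 0 <= ln (2 : R) by rewrite ln_ge0// ler1n.
have C0_ge0 : 0 <= C0 by rewrite !mulr_ge0.
exists (1 + C0) => A _ _ freeA; rewrite limf_einfE.
apply: ge_ereal_sup => _ [V [M [_ MV]] <-].
pose a j : nat := Posz j.+1 \in A.
have moment N : (0 < N)%N ->
    (\sum_(i < N) (\sum_(t < N) a (i * N + t)%N) ^ p <= K * N ^ p.-1)%N.
  move=> N_gt0; under eq_bigr do rewrite -card_trace_block.
  exact: HK.
(* This choice of n makes 2^n, hence x, exceed M. *)
pose n := (Num.truncn `|M|).+1.
have [k0 k0n bound] := HW K a moment n isT.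
pose x : R := (2 ^ (n + k0))%:R.
apply: ge_ereal_inf; eexists.
  exists x; last by [].
  apply: MV; rewrite (le_lt_trans (ler_norm _))//.
  rewrite (lt_le_trans (truncnS_gt _))// ler_nat.
  rewrite (leq_trans (ltnW (ltn_expl _ (leqnn 2))))//.
  by rewrite leq_exp2l// leq_addr.
have x_gt0 : 0 < x by rewrite ltr0n expn_gt0.
have xE : x = 2 ^+ (n + k0) by rewrite /x natrX.
have lnx : ln x <= 2 * n%:R * ln 2.
  rewrite xE lnXn// -[leLHS]mulr_natl ler_wpM2r// -natrM ler_nat mul2n -addnn.
  by rewrite leq_add2l ltnW.
have lnx_ge0 : 0 <= ln x by rewrite ln_ge0// xE exprn_ege1// ler1n.
move: bound; rewrite lee_fin -(counting_nat R) -/x -xE.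
move: (counting A x) => c bound.
have p_gt0 : (0 < p)%N by rewrite ltnW.
have root : ((x * ln x) `^ p%:R^-1) ^+ p = x * ln x.
  rewrite -powR_mulrn ?powR_ge0// -powRrM mulVf ?powRr1//.
    by rewrite mulr_ge0// ltW.
  by rewrite pnatr_eq0 -lt0n.
rewrite -(ler_pXn2r p_gt0) ?nnegrE; first last.
- by rewrite addr_ge0.
- by rewrite mulr_ge0 ?powR_ge0// divr_ge0// ltW.
apply: (@le_trans _ _ C0); last first.
  apply: (@le_trans _ _ (1 + C0)); first by rewrite lerDr.
  by rewrite ler_eXnr// lerDl.
rewrite exprMn root expr_div_n -{2}(prednK p_gt0) exprSr.
have -> : c%:R ^+ p / (x ^+ p.-1 * x) * (x * ln x) =
    c%:R ^+ p * ln x / x ^+ p.-1.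
  by field; rewrite expf_neq0 gt_eqF.
rewrite ler_pdivrMr ?exprn_gt0//.
apply: (le_trans (ler_wpM2l _ lnx)); first by rewrite exprn_ge0.
have := ler_wpM2l (mulr_ge0 (ler0n R 2) ln2_ge0) bound.
by rewrite /C0; congr (_ <= _); ring.
Qed.
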